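(* Let $I\subset\mathbb{R}$ be a closed interval and $\Phi:I\to\mathbb{R}$ a smooth convex function. Let $(\Omega,\mathcal{F},\mu)$ be a probability space, $\mathcal{A}$ a class of measurable functions from $\Omega$ to $I$, and $\mathcal{E}:\mathcal{A}\to L^1(\Omega,\mathcal{F},\mu;\mathbb{R}_+)$ a functional. Suppose there is $c>0$ such that $$\forall f\in\mathcal{A},\qquad \mathrm{Ent}^\Phi_\mu(f)\le c\int_\Omega\mathcal{E}(f)\,d\mu .$$ Then for every bounded measurable function $B:\Omega\to\mathbb{R}$, $$\forall f\in\mathcal{A},\qquad \mathrm{Ent}^\Phi_{\nu_B}(f)\le c\,e^{2\,\mathrm{osc}(B)}\int_\Omega\mathcal{E}(f)\,d\nu_B,$$ where $\nu_B$ is the probability measure $d\nu_B:=\Big(\int e^{B}\,d\mu\Big)^{-1}e^{B}\,d\mu$.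
   Context: For a probability measure $\mu$ and a $\mu$-integrable $f$ with values in $I$, $\mathrm{Ent}^\Phi_\mu(f):=\int\Phi(f)\,d\mu-\Phi\big(\int f\,d\mu\big)\in[0,+\infty]$; the functional is only considered on integrable functions. $\mathrm{osc}(B):=\sup B-\inf B$. *)

(* Defs.v *)
(* MathComp-Analysis, over an abstract [R : realType] *)
From HB Require Import structures.
From mathcomp Require Import all_boot all_order all_algebra.
From mathcomp Require Import all_classical all_reals all_analysis.
From mathcomp Require Import measurable_realfun.

Set Implicit Arguments.
Unset Strict Implicit.
Unset Printing Implicit Defensive.

Import Order.TTheory GRing.Theory Num.Theory.
Import numFieldNormedType.Exports.

Local Open Scope classical_set_scope.
Local Open Scope ring_scope.

(* Smoothness on an interval: continuity on [I] (one-sided at the endpoints that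
   belong to [I]) and derivatives of all orders in the interior.  Derivatives are
   not required to extend to the endpoints, so that [x * ln x] is smooth on
   [0, +oo[; this is implied by smoothness up to the boundary.  The values of
   [Phi] outside [I] are irrelevant, since the interior is open. *)
Definition smooth_on (R : realType) (I : set R) (Phi : R -> R) : Prop :=
  {within I, continuous Phi} /\
  forall (n : nat) (x : R), I° x -> derivable (derive1n n Phi) x 1.

(* For an integrable [f], the [Rintegral] below is the mean of [f]; the integral
   of [Phi \o f] is extended-real valued. *)
Definition Ent (d : measure_display) (T : measurableType d) (R : realType)
    (Phi : R -> R) (mu : probability T R) (f : T -> R) : \bar R :=
  (\int[mu]_x (Phi (f x))%:E - (Phi (\int[mu]_x f x)%R)%:E)%E.

Definition osc (T : Type) (R : realType) (B : T -> R) : R :=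
  sup (range B) - inf (range B).

Section gibbs.
Context (d : measure_display) (T : measurableType d) (R : realType).
Variables (mu : probability T R) (B : T -> R).
Hypotheses (mB : measurable_fun [set: T] B) (bB : bounded_fun B).

Definition partition_function : R := (\int[mu]_x expR (B x))%R.

(* The measurability and boundedness proofs are arguments so that the
   probability instance below can be attached to [gibbs]. *)
Definition gibbs of measurable_fun [set: T] B & bounded_fun B :
    set T -> \bar R :=
  fun A => (\int[mu]_(x in A) ((partition_function)^-1 * expR (B x))%:E)%E.

Let measurable_expB : measurable_fun [set: T] (expR \o B).
Proof. exact: measurableT_comp. Qed.

Let finite_muT : (mu [set: T] < +oo)%E.
Proof. by rewrite [mu _]probability_setT ltry. Qed.

Let integrable_expB : mu.-integrable [set: T] (EFin \o (expR \o B)).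
Proof.
apply: measurable_bounded_integrable => //.
case: bB => M [Mr HM]; exists (expR (M + 1)); split; first by rewrite num_real.
move=> y ly x _ /=; apply: le_trans (ltW ly).
rewrite ger0_norm ?expR_ge0// ler_expR.
apply: le_trans (ler_norm _) _.
by apply: HM => //; rewrite ltrDl.
Qed.

Lemma partition_function_gt0 : 0 < partition_function.
Proof.
case: bB => M [Mr HM].
rewrite (@lt_le_trans _ _ (expR (- (M + 1))))// ?expR_gt0//.
have -> : expR (- (M + 1)) = (\int[mu]_(x in [set: T]) cst (expR (- (M + 1))) x)%R.
  by rewrite Rintegral_cst//= [mu _]probability_setT/= mulr1.
apply: le_Rintegral => //.
  apply: measurable_bounded_integrable => //.
  exact: bounded_cst.
move=> x _ /=; rewrite ler_expR lerNl.
apply: le_trans (ler_norm _) _; rewrite normrN.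
by apply: HM => //; rewrite ltrDl.
Qed.

Let density_ge0 x : 0 <= partition_function^-1 * expR (B x).
Proof. by rewrite mulr_ge0 ?expR_ge0// invr_ge0 ltW// partition_function_gt0. Qed.

Let gibbs0 : gibbs mB bB set0 = 0%E.
Proof. by rewrite /gibbs integral_set0. Qed.

Let gibbs_ge0 A : (0 <= gibbs mB bB A)%E.
Proof. by apply: integral_ge0 => x _; rewrite lee_fin. Qed.

Let gibbs_sigma_additive : semi_sigma_additive (gibbs mB bB).
Proof.
apply: semi_sigma_additive_nng_induced.
  by apply/measurable_EFinP; apply: measurable_funM.
by move=> x; rewrite lee_fin.
Qed.

HB.instance Definition _ := isMeasure.Build _ _ _ (gibbs mB bB)
  gibbs0 gibbs_ge0 gibbs_sigma_additive.

Let gibbs_setT : gibbs mB bB [set: T] = 1%E.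
Proof.
rewrite /gibbs; under eq_integral do rewrite EFinM.
rewrite integralZl//.
have -> : (\int[mu]_x (expR (B x))%:E)%E = partition_function%:E.
  by rewrite /partition_function /Rintegral fineK//; exact: integrable_fin_num.
by rewrite -EFinM mulVf// gt_eqF// partition_function_gt0.
Qed.

HB.instance Definition _ := Measure_isProbability.Build _ _ _ (gibbs mB bB)
  gibbs_setT.

End gibbs.

(* Main.v *)
(* Holley-Stroock perturbation.  If [Phi m + k (z - m)] is a supporting line of
   [Phi] at [m], the mean of [f] under [mu], then [Ent Phi mu f] is the
   [mu]-integral of the nonnegative function
   [Phi f - (Phi m + k (f - m))], whose integral under any other probability
   [nu] is at least [Ent Phi nu f].  Hence a bound [nu <= k1 mu] gives
   [Ent Phi nu f <= k1 Ent Phi mu f]; a bound [mu <= k2 nu] transfers the energy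
   back.  For the Gibbs measure [k1 = e^(sup B) / Z] and [k2 = Z e^(- inf B)], so
   that [k1 k2 = e^(osc B)], which is even better than [e^(2 osc B)].  When [m]
   is an endpoint of [I] there need not be a supporting line, but then [f = m]
   almost everywhere. *)
Require Import Defs.
From mathcomp Require Import all_boot all_order all_algebra.
From mathcomp Require Import all_classical all_reals all_analysis.
From mathcomp Require Import measurable_realfun lra ring.

Import Order.TTheory GRing.Theory Num.Theory.
Import numFieldNormedType.Exports.

Local Open Scope classical_set_scope.
Local Open Scope ring_scope.

(** * Supporting lines of a convex function and the mean of a function with values in [I] *)

(** Chords ending at [t] from the left have slopes at most those of chords starting at [t] to the
    right. The points [x] and [y] make the set of left slopes nonempty and bounded above, and its
    supremum serves as [k]. *)
Lemma convex_function_supporting_line (R : realType) (I : set R) (Phi : R -> R)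
    (x t y : R) :
  convex_function I Phi -> I x -> I t -> I y -> x < t < y ->
  exists k : R, forall z, I z -> Phi t + k * (z - t) <= Phi z.
Proof.
move=> cPhi Ix It Iy /andP[xt ty].
have slopeE u v : I u -> I v -> u < t -> t < v ->
    (Phi t - Phi u) / (t - u) <= (Phi v - Phi t) / (v - t).
  move=> Iu Iv ut tv.
  have uv : 0 < v - u by rewrite subr_gt0 (lt_trans ut).
  have a0 : 0 <= (v - t) / (v - u).
    by rewrite divr_ge0// subr_ge0 ltW// (lt_trans ut).
  have a1 : (v - t) / (v - u) <= 1.
    by rewrite ler_pdivrMr// mul1r lerD2l lerN2 ltW.
  (* With this weight on [u], the convex combination of [u] and [v] is exactly [t]. *)
  pose a : {i01 R} := Itv01 a0 a1.
  have : Phi ((v - t) / (v - u) * u + (1 - (v - t) / (v - u)) * v) <=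
      (v - t) / (v - u) * Phi u + (1 - (v - t) / (v - u)) * Phi v.
    exact: (cPhi a u v (mem_set Iu) (mem_set Iv)).
  have -> : (v - t) / (v - u) * u + (1 - (v - t) / (v - u)) * v = t.
    by field; rewrite gt_eqF.
  have -> : (v - t) / (v - u) * Phi u + (1 - (v - t) / (v - u)) * Phi v =
      ((v - t) * Phi u + (t - u) * Phi v) / (v - u).
    by field; rewrite gt_eqF.
  rewrite ler_pdivlMr// => H.
  rewrite ler_pdivrMr ?subr_gt0// mulrAC ler_pdivlMr ?subr_gt0//.
  lra.
pose S := [set (Phi t - Phi u) / (t - u) | u in [set u | I u /\ u < t]].
have S_ub v : I v -> t < v -> ubound S ((Phi v - Phi t) / (v - t)).
  by move=> Iv tv _ [u [Iu ut] <-]; exact: slopeE.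
have S0 : S !=set0 by exists ((Phi t - Phi x) / (t - x)), x.
have hS : has_sup S.
  by split => //; exists ((Phi y - Phi t) / (y - t)); exact: S_ub.
exists (sup S) => z Iz; have [zt|tz|->] := ltgtP z t.
- have : (Phi t - Phi z) / (t - z) <= sup S.
    by apply: sup_upper_bound => //; exists z.
  rewrite ler_pdivrMr ?subr_gt0//; lra.
- have : sup S <= (Phi z - Phi t) / (z - t).
    by apply: ge_sup => //; exact: S_ub.
  rewrite ler_pdivlMr ?subr_gt0//; lra.
- by rewrite subrr mulr0 addr0.
Qed.

Lemma ge0_Rintegral_eq0 {d} {T : measurableType d} {R : realType}
    (mu : {measure set T -> \bar R}) (g : T -> R) :
  mu.-integrable [set: T] (EFin \o g) -> (forall x, 0 <= g x) ->
  (\int[mu]_x g x)%R = 0 -> {ae mu, forall x, g x = 0}.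
Proof.
move=> ig g0 g_eq0.
have mg := measurable_int _ ig.
have : (\int[mu]_x `|(EFin \o g) x| = 0)%E.
  under eq_integral do rewrite /= ger0_norm//.
  rewrite -[LHS]fineK ?integrable_fin_num//.
  by congr EFin.
move/(ae_eq_integral_abs _ measurableT mg); apply: filterS => x /(_ Logic.I) /=.
by case.
Qed.

(** If [I] missed the mean [m], all values of [f] would lie strictly on one side of [m]. Then
    [f - m] has constant sign and zero integral, so [f = m] almost everywhere, which is absurd on a
    space of mass one. *)
Lemma Rintegral_is_interval {d} {T : measurableType d} {R : realType}
    (P : probability T R) (I : set R) (f : T -> R) :
  is_interval I -> P.-integrable [set: T] (EFin \o f) -> range f `<=` I ->
  I (\int[P]_x f x).
Proof.
move=> itvI iF fI; set m := (\int[P]_x f x).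
have ic : P.-integrable [set: T] (EFin \o cst m).
  exact: finite_measure_integrable_cst.
have Rc : (\int[P]_x (cst m x))%R = m.
  by rewrite Rintegral_cst//= [P _]probability_setT/= mulr1.
have aeF : ~ {ae P, forall x : T, False}.
  case=> N [mN PN0 /= sub].
  have : (P [set: T] <= P N)%E.
    by apply: le_measure; rewrite ?inE// => x _; apply: sub.
  by rewrite PN0 [P _]probability_setT leNgt lte01.
apply: contrapT => nIm.
have neq x : f x != m.
  by apply/eqP => fxm; apply: nIm; rewrite -fxm; apply: fI; exists x.
have [[x0 fx0]|] := pselect (exists x, f x < m).
- have lt x : f x < m.
    rewrite lt_neqAle neq leNgt; apply/negP => mfx; apply: nIm.
    apply: (itvI (f x0) (f x)); [by apply: fI; exists x0|by apply: fI; exists x|].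
    by rewrite (ltW fx0) (ltW mfx).
  apply: aeF; apply: filterS (ge0_Rintegral_eq0 P (cst m \- f) _ _ _).
  + by move=> x /eqP; rewrite subr_eq0 eq_sym (negbTE (neq x)).
  + exact: (integrableB measurableT ic iF).
  + by move=> x /=; rewrite subr_ge0 ltW.
  + by rewrite RintegralB// Rc subrr.
- move=> /forallNP ge.
  apply: aeF; apply: filterS (ge0_Rintegral_eq0 P (f \- cst m) _ _ _).
  + by move=> x /eqP; rewrite subr_eq0 (negbTE (neq x)).
  + exact: (integrableB measurableT iF ic).
  + by move=> x /=; rewrite subr_ge0 leNgt; apply/negP; exact: ge.
  + by rewrite RintegralB// Rc subrr.
Qed.

(** The line is required only along [f] and at means under [Q], so that the case of [m] an endpoint
    of [I] is covered: there [f = m] almost everywhere for [P], hence for [Q], both means coincide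
    and slope 0 works. *)
Lemma convex_supporting_line_Rintegral {d} {T : measurableType d} {R : realType}
    (I : set R) (Phi : R -> R) (P : probability T R) (f : T -> R) :
  is_interval I -> convex_function I Phi -> range f `<=` I ->
  P.-integrable [set: T] (EFin \o f) ->
  let m := (\int[P]_x f x)%R in
  exists2 k : R, {ae P, forall x, Phi m + k * (f x - m) <= Phi (f x)} &
    forall Q : probability T R, Q `<< P -> Q.-integrable [set: T] (EFin \o f) ->
      let m' := (\int[Q]_x f x)%R in Phi m + k * (m' - m) <= Phi m'.
Proof.
move=> itvI cPhi fI iF m.
have Im : I m by exact: Rintegral_is_interval.
have ic : P.-integrable [set: T] (EFin \o cst m).
  exact: finite_measure_integrable_cst.
have Rc (Q : probability T R) : (\int[Q]_x (cst m x))%R = m.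
  by rewrite Rintegral_cst//= [Q _]probability_setT/= mulr1.
have trivial_case : {ae P, forall x, f x = m} -> exists2 k : R,
    {ae P, forall x, Phi m + k * (f x - m) <= Phi (f x)} &
    forall Q : probability T R, Q `<< P -> Q.-integrable [set: T] (EFin \o f) ->
      let m' := (\int[Q]_x f x)%R in Phi m + k * (m' - m) <= Phi m'.
  move=> fm; exists 0.
    by apply: filterS fm => x ->; rewrite mul0r addr0.
  move=> Q QP iQ; set m' := (X in let m' := X in _) => /=.
  suff -> : m' = m by rewrite mul0r addr0.
  rewrite /m' -[RHS](Rc Q); congr fine; apply: ae_eq_integral => //.
    exact: measurable_int iQ.
    exact: measurable_int ic.
  apply: (null_dominates_ae_eq measurableT QP).
  by apply: filterS fm => x /= -> _.
(* Without a point of [I] below [m], [f - m] is nonnegative with zero integral; the case of no point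
   above is symmetric. *)
have [[x [Ix xm]]|noL] := pselect (exists x, I x /\ x < m); last first.
  apply: trivial_case.
  apply: filterS (ge0_Rintegral_eq0 P (f \- cst m) _ _ _).
  + by move=> x /eqP; rewrite subr_eq0 => /eqP.
  + exact: (integrableB measurableT iF ic).
  + move=> x /=; rewrite subr_ge0 leNgt; apply/negP => fxm.
    by apply: noL; exists (f x); split => //; apply: fI; exists x.
  + by rewrite RintegralB// Rc subrr.
have [[y [Iy my]]|noR] := pselect (exists y, I y /\ m < y); last first.
  apply: trivial_case.
  apply: filterS (ge0_Rintegral_eq0 P (cst m \- f) _ _ _).
  + by move=> z /eqP; rewrite subr_eq0 => /eqP.
  + exact: (integrableB measurableT ic iF).
  + move=> z /=; rewrite subr_ge0 leNgt; apply/negP => fzm.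
    by apply: noR; exists (f z); split => //; apply: fI; exists z.
  + by rewrite RintegralB// Rc subrr.
have [k kP] : exists k : R, forall z, I z -> Phi m + k * (z - m) <= Phi z.
  by apply: (convex_function_supporting_line _ _ _ x m y cPhi) => //; rewrite xm.
exists k; first by apply: aeW => z; apply: kP; apply: fI; exists z.
by move=> Q _ iQ; apply: kP; exact: Rintegral_is_interval.
Qed.

(** * Integrability from one-sided bounds, and integrals under dominated measures *)

(** The negative part of [g] is bounded by that of [l], so its integral is finite; an infinite
    integral of the positive part would then force the integral of [g] to be [+oo]. *)
Lemma ae_ge_integrable {d} {T : measurableType d} {R : realType}
    (mu : {measure set T -> \bar R}) (l g : T -> \bar R) :
  mu.-integrable [set: T] l -> measurable_fun [set: T] g ->
  {ae mu, forall x, (l x <= g x)%E} -> (\int[mu]_x g x < +oo)%E ->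
  mu.-integrable [set: T] g.
Proof.
move=> il mg lg goo; have ml := measurable_int _ il.
have negoo : (\int[mu]_x g^\- x < +oo)%E.
  apply: le_lt_trans (integral_funeneg_lt_pinfty measurableT il).
  apply: ae_ge0_le_integral => //; [exact: measurable_funeneg..|].
  apply: filterS lg => x lgx _.
  by rewrite !funenegE ge_max le_max leeN2 lgx /= le_max lexx orbT.
have posoo : (\int[mu]_x g^\+ x < +oo)%E.
  rewrite ltNge leye_eq; apply/negP => /eqP posE.
  move: goo; rewrite integralE posE.
  by rewrite addye ?ltxx// eqe_oppLR/= lt_eqF.
apply/integrableP; split => //.
rewrite -/(comp abse g) fune_abse ge0_integralD//.
- by rewrite lte_add_pinfty.
- exact: measurable_funepos.
- exact: measurable_funeneg.
Qed.

Lemma ae_ge0_integral_funepos {d} {T : measurableType d} {R : realType}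
    (mu : {measure set T -> \bar R}) (f : T -> \bar R) :
  measurable_fun [set: T] f -> {ae mu, forall x, 0 <= f x}%E ->
  (\int[mu]_x f x = \int[mu]_x f^\+ x)%E.
Proof.
move=> mf f0; apply: ae_eq_integral => //; first exact: measurable_funepos.
by apply: filterS f0 => x fx0 _; rewrite funeposE; apply/esym/max_idPl.
Qed.

Lemma null_dominates_ae {d} {T : measurableType d} {R : realType}
    (m1 m2 : {measure set T -> \bar R}) (P : T -> Prop) :
  m1 `<< m2 -> {ae m2, forall x, P x} -> {ae m1, forall x, P x}.
Proof.
move=> /null_content_dominatesP m12_0 [N [mN N0 PN]].
by exists N; split => //; exact: m12_0.
Qed.

Section dominated.
Context {d} {T : measurableType d} {R : realType}.
Variables (m1 m2 : {measure set T -> \bar R}) (k : R).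
Hypothesis k_ge0 : 0 <= k.
Hypothesis m12 : forall A, measurable A -> (m1 A <= k%:E * m2 A)%E.

Lemma le_scale_null_dominates : m1 `<< m2.
Proof.
apply/null_content_dominatesP => A mA A0; apply/eqP.
by rewrite -measure_le0 (le_trans (m12 _ mA))// A0 mule0.
Qed.

Lemma ge0_le_scale_integral (f : T -> \bar R) :
  measurable_fun [set: T] f -> (forall x, 0 <= f x)%E ->
  (\int[m1]_x f x <= k%:E * \int[m2]_x f x)%E.
Proof.
move=> mf f0.
(* [k] times [m2] is itself a measure, so monotonicity of the integral in the measure applies. *)
rewrite -[k%:E]/((NngNum k_ge0)%:num%:E) -ge0_integral_mscale//.
by apply: ge0_le_measure_integral.
Qed.

Lemma ae_ge0_le_scale_integral (f : T -> \bar R) :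
  measurable_fun [set: T] f -> {ae m2, forall x, 0 <= f x}%E ->
  (\int[m1]_x f x <= k%:E * \int[m2]_x f x)%E.
Proof.
move=> mf f2.
have f1 := null_dominates_ae _ _ _ le_scale_null_dominates f2.
rewrite (ae_ge0_integral_funepos m1)// (ae_ge0_integral_funepos m2)//.
by apply: ge0_le_scale_integral => //; exact: measurable_funepos.
Qed.

Lemma le_scale_integrable (f : T -> \bar R) :
  m2.-integrable [set: T] f -> m1.-integrable [set: T] f.
Proof.
move=> /integrableP[mf foo]; apply/integrableP; split => //.
apply: le_lt_trans (ge0_le_scale_integral (abse \o f) _ _) _.
- exact: measurableT_comp.
- by move=> x /=; exact: abse_ge0.
- by rewrite lte_mul_pinfty// lee_fin.
Qed.

End dominated.

(** * Entropy as the integral of a gap above a supporting line *)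

Section entropy.
Context {d} {T : measurableType d} {R : realType}.
Variables (I : set R) (Phi : R -> R) (f : T -> R).
Hypotheses (itvI : is_interval I) (cPhi : convex_function I Phi).
Hypotheses (fI : range f `<=` I).

(** As [P] has mass one, an affine function of [f] integrates to its value at the mean of [f]. Here
    [m] is free: it stays the mean under the first measure when the integral is taken under the
    second. *)
Lemma integral_subr_affine (P : probability T R) (g : T -> R) (a k m : R) :
  P.-integrable [set: T] (EFin \o g) -> P.-integrable [set: T] (EFin \o f) ->
  (\int[P]_x (g x - (a + k * (f x - m)))%:E =
   \int[P]_x (g x)%:E - (a + k * ((\int[P]_x f x)%R - m))%:E)%E.
Proof.
move=> ig iF.
have ic c : P.-integrable [set: T] (EFin \o cst c).
  exact: finite_measure_integrable_cst.
have iB : P.-integrable [set: T] (EFin \o (f \- cst m)).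
  exact: (integrableB measurableT iF (ic m)).
have iZ : P.-integrable [set: T] (EFin \o (fun x => k * (f x - m))).
  exact: (integrableZl measurableT k iB).
have iA : P.-integrable [set: T] (EFin \o (fun x => a + k * (f x - m))).
  exact: (integrableD measurableT (ic a) iZ).
have Rc c : (\int[P]_x (cst c x))%R = c.
  by rewrite Rintegral_cst//= [P _]probability_setT/= mulr1.
rewrite integralB_EFin//; congr (_ - _)%E.
rewrite -[LHS]fineK ?integrable_fin_num//; congr EFin.
rewrite -/(Rintegral P _ _) (RintegralD _ (ic a) iZ)// Rc; congr (_ + _).
rewrite (RintegralZl _ measurableT iB)//; congr (_ * _).
by rewrite (RintegralB _ iF (ic m))// Rc.
Qed.

(** The supporting line gives an integrable lower bound for [Phi \o f], and finite entropy bounds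
    its integral from above. *)
Lemma Ent_lty_integrable (P : probability T R) :
  measurable_fun [set: T] (Phi \o f) -> P.-integrable [set: T] (EFin \o f) ->
  (Ent Phi P f < +oo)%E -> P.-integrable [set: T] (EFin \o (Phi \o f)).
Proof.
move=> mPf iF entoo.
have [k supp _] := convex_supporting_line_Rintegral _ _ _ _ itvI cPhi fI iF.
set m := Rintegral _ _ _ in supp.
have ic c : P.-integrable [set: T] (EFin \o cst c).
  exact: finite_measure_integrable_cst.
have iB : P.-integrable [set: T] (EFin \o (f \- cst m)).
  exact: (integrableB measurableT iF (ic m)).
have iA := integrableD measurableT (ic (Phi m)) (integrableZl measurableT k iB).
apply: (ae_ge_integrable _ _ _ iA).
- exact/measurable_EFinP.
- by apply: filterS supp => x; rewrite /= -EFinM -EFinD lee_fin.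
- by move: entoo; rewrite /Ent lteBlDr.
Qed.

Lemma Ent_le_scale (P Q : probability T R) (k : R) :
  0 <= k -> (forall A, measurable A -> (Q A <= k%:E * P A)%E) ->
  P.-integrable [set: T] (EFin \o f) ->
  P.-integrable [set: T] (EFin \o (Phi \o f)) ->
  (Ent Phi Q f <= k%:E * Ent Phi P f)%E.
Proof.
move=> k0 QP iP iPhiP.
have iQ := le_scale_integrable _ _ _ k0 QP _ iP.
have iPhiQ := le_scale_integrable _ _ _ k0 QP _ iPhiP.
have [s suppP suppQ] := convex_supporting_line_Rintegral _ _ _ _ itvI cPhi fI iP.
have {}suppQ := suppQ Q (le_scale_null_dominates _ _ _ QP) iQ.
set m := Rintegral P _ _ in suppP suppQ.
pose h x := Phi (f x) - (Phi m + s * (f x - m)).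
have hP : (\int[P]_x (h x)%:E = Ent Phi P f)%E.
  by rewrite /h (integral_subr_affine P (Phi \o f))// subrr mulr0 addr0.
(* Under [Q] the line averages to its value at the [Q]-mean of [f], which [suppQ] bounds by [Phi]
   there. *)
have hQ : (Ent Phi Q f <= \int[Q]_x (h x)%:E)%E.
  rewrite /h (integral_subr_affine Q (Phi \o f))//.
  by rewrite leeB// lee_fin.
rewrite -hP (le_trans hQ)//; apply: ae_ge0_le_scale_integral => //.
  apply/measurable_EFinP; apply: measurable_funB.
    by apply/measurable_EFinP; exact: measurable_int iPhiP.
  apply: measurable_funD => //; apply: measurable_funM => //.
  apply: measurable_funB => //.
  by apply/measurable_EFinP; exact: measurable_int iP.
by apply: filterS suppP => x; rewrite lee_fin subr_ge0.
Qed.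

End entropy.

(** * Two-sided comparison of the Gibbs measure with [mu] *)

Section gibbs_bounds.
Context {d} {T : measurableType d} {R : realType}.
Variables (mu : probability T R) (B : T -> R).
Hypotheses (mB : measurable_fun [set: T] B) (bB : bounded_fun B).
Let Z := partition_function mu B.

Lemma bounded_fun_has_bounds : has_ubound (range B) /\ has_lbound (range B).
Proof.
(* [bounded_fun] provides bounds only strictly above [M], hence [M + 1]. *)
case: bB => M [_ /(_ (M + 1))]; rewrite ltrDl ltr01 => /(_ isT) HM.
by split; [exists (M + 1)|exists (- (M + 1))] => _ [x _ <-];
  have := HM x Logic.I; rewrite /= ler_norml => /andP[].
Qed.

Let mdens : measurable_fun [set: T] (fun x => (Z^-1 * expR (B x))%:E).
Proof.
by apply/measurable_EFinP; apply: measurable_funM => //; exact: measurableT_comp.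
Qed.

Let Zgt0 : 0 < Z := partition_function_gt0 mu mB bB.

Lemma gibbs_le A : measurable A ->
  (gibbs mu mB bB A <= (Z^-1 * expR (sup (range B)))%:E * mu A)%E.
Proof.
move=> mA; rewrite -integral_cst// /gibbs; apply: ge0_le_integral => //.
- by move=> x _; rewrite lee_fin mulr_ge0 ?expR_ge0// invr_ge0 ltW.
- exact: measurable_funTS.
- move=> x _; rewrite lee_fin ler_pM2l ?invr_gt0// ler_expR.
  by apply: ub_le_sup; [case: bounded_fun_has_bounds|exists x].
Qed.

Lemma le_gibbs A : measurable A ->
  (mu A <= (Z * expR (- inf (range B)))%:E * gibbs mu mB bB A)%E.
Proof.
move=> mA.
have : ((Z^-1 * expR (inf (range B)))%:E * mu A <= gibbs mu mB bB A)%E.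
  rewrite -integral_cst// /gibbs; apply: ge0_le_integral => //.
  - by move=> x _; rewrite lee_fin mulr_ge0 ?expR_ge0// invr_ge0 ltW.
  - exact: measurable_funTS.
  - move=> x _; rewrite lee_fin ler_pM2l ?invr_gt0// ler_expR.
    by apply: ge_inf; [case: bounded_fun_has_bounds|exists x].
(* This constant is the inverse of the lower bound on the density, and multiplying by it isolates
   [mu A]. *)
have k0 : (0 <= (Z * expR (- inf (range B)))%:E)%E.
  by rewrite lee_fin mulr_ge0 ?expR_ge0// ltW.
move=> /(lee_wpmul2l k0); apply: le_trans.
rewrite muleA -EFinM expRN mulrACA mulfV ?mulVf ?gt_eqF ?expR_gt0//.
by rewrite mul1r mul1e.
Qed.

Lemma osc_ge0 : 0 <= osc B.
Proof.
have [ub lb] := bounded_fun_has_bounds.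
(* The mass one of [mu] provides a point, whose value lies between the infimum and the supremum. *)
have [x] : [set: T] !=set0.
  apply/set0P/eqP => T0; have := probability_setT mu.
  by rewrite T0 measure0 => /esym/eqP; rewrite onee_eq0.
move=> _; rewrite subr_ge0 (@le_trans _ _ (B x))//.
  by apply: ge_inf => //; exists x.
by apply: ub_le_sup => //; exists x.
Qed.

End gibbs_bounds.

(** * Transfer of the entropy inequality from [mu] to the Gibbs measure *)

Theorem proposition17 (R : realType) (I : set R) (Phi : R -> R)
  (d : measure_display) (T : measurableType d) (mu : probability T R)
  (A : set (T -> R)) (E : (T -> R) -> (T -> R)) (c : R)
  (itvI : is_interval I) (closedI : closed I)
  (smoothPhi : smooth_on I Phi)
  (convexPhi : convex_function I Phi)
  (measA : forall f, A f -> measurable_fun [set: T] f)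
  (rangeA : forall f, A f -> range f `<=` I)
  (intE : forall f, A f -> mu.-integrable [set: T] (EFin \o E f))
  (ge0E : forall f, A f -> {ae mu, forall x, 0 <= E f x})
  (c_gt0 : 0 < c)
  (entropy_mu : forall f, A f -> mu.-integrable [set: T] (EFin \o f) ->
    (Ent Phi mu f <= c%:E * \int[mu]_x (E f x)%:E)%E) :
  forall (B : T -> R) (mB : measurable_fun [set: T] B) (bB : bounded_fun B)
    (f : T -> R), A f ->
    (gibbs mu mB bB).-integrable [set: T] (EFin \o f) ->
    (Ent Phi (gibbs mu mB bB) f <=
      (c * expR (2 * osc B))%:E * \int[gibbs mu mB bB]_x (E f x)%:E)%E.
Proof.
move=> B mB bB f Af iFnu.
set nu := gibbs mu mB bB.
pose Z := partition_function mu B.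
have Z0 : 0 < Z := partition_function_gt0 mu mB bB.
pose k1 := Z^-1 * expR (sup (range B)); pose k2 := Z * expR (- inf (range B)).
have k1_ge0 : 0 <= k1 by rewrite mulr_ge0 ?expR_ge0// invr_ge0 ltW.
have k2_ge0 : 0 <= k2 by rewrite mulr_ge0 ?expR_ge0// ltW.
have k12 : k1 * k2 = expR (osc B).
  by rewrite /k1 /k2 mulrACA mulVf ?gt_eqF// mul1r -expRD.
have nu_mu A' : measurable A' -> (nu A' <= k1%:E * mu A')%E.
  exact: gibbs_le.
have mu_nu A' : measurable A' -> (mu A' <= k2%:E * nu A')%E.
  exact: le_gibbs.
(* Integrability is given under [nu]; it passes to [mu], where [entropy_mu] can be applied. *)
have iF := le_scale_integrable _ _ _ k2_ge0 mu_nu _ iFnu.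
(* [Phi] is controlled only on [I], so measurability comes from its continuity within [I] and from
   [f] taking values there. *)
have mPf : measurable_fun [set: T] (Phi \o f).
  apply: (measurable_comp (is_interval_measurable itvI) _ _ (measA f Af)).
    exact: rangeA.
  apply: subspace_continuous_measurable_fun; first exact: is_interval_measurable.
  by case: smoothPhi.
have mE := measurable_int _ (intE f Af).
have entE := entropy_mu f Af iF.
have iPhi : mu.-integrable [set: T] (EFin \o (Phi \o f)).
  apply: (Ent_lty_integrable _ _ _ itvI convexPhi (rangeA f Af)) => //.
  apply: le_lt_trans entE _; rewrite lte_mul_pinfty ?lee_fin ?ltW//.
  exact: integrable_lty (intE f Af).
have E0 : {ae mu, forall x, 0 <= (E f x)%:E}%E.
  by apply: filterS (ge0E f Af) => x; rewrite lee_fin.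
(* The sign of the energy under [nu] allows enlarging the constant in front of it at the end. *)
have Enu0 : (0 <= \int[nu]_x (E f x)%:E)%E.
  rewrite ae_ge0_integral_funepos ?integral_ge0//.
  exact: null_dominates_ae _ _ _ (le_scale_null_dominates _ _ _ nu_mu) E0.
have step2 : (\int[mu]_x (E f x)%:E <= k2%:E * \int[nu]_x (E f x)%:E)%E.
  apply: ae_ge0_le_scale_integral => //.
  exact: null_dominates_ae _ _ _ (le_scale_null_dominates _ _ _ nu_mu) E0.
have step1 : (Ent Phi nu f <= k1%:E * Ent Phi mu f)%E.
  exact: (Ent_le_scale _ _ _ itvI convexPhi (rangeA f Af)).
apply: le_trans step1 _.
apply: (@le_trans _ _ (k1%:E * (c%:E * (k2%:E * \int[nu]_x (E f x)%:E)))%E).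
  rewrite lee_wpmul2l ?lee_fin// (le_trans entE)//.
  by rewrite lee_wpmul2l ?lee_fin// ltW.
rewrite !muleA -!EFinM lee_wpmul2r// lee_fin mulrAC k12 mulrC.
(* Since [osc B] is nonnegative, [expR (osc B)] is at most [expR (2 * osc B)]. *)
by rewrite ler_pM2l// ler_expR ler_peMl ?(osc_ge0 mu)// ler1n.
Qed.
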